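(* Let $X=[0,1]\subset\mathbb{R}$ and let $\boldsymbol{\xi},\boldsymbol{\xi}^1,\boldsymbol{\xi}^2,\ldots$ be iid random variables on a complete probability space $(\Omega,\mathcal{F},\mathbb{P})$, each uniformly distributed on $\Xi=[0,1]$. There exist a Carathéodory function $h:\Xi\times\mathbb{R}\to\mathbb{R}$, with $x\mapsto\mathbb{E}[h(\boldsymbol{\xi},x)]$ finite-valued and with $h(\xi,\cdot)$ being $L(\xi)$-Lipschitz on an open neighborhood of $X$ for every $\xi\in\Xi$ for some measurable $L$ with $\mathbb{E}[L(\boldsymbol{\xi})]<\infty$, and random points $\{\boldsymbol{x}^\nu:\Omega\to X\}_{\nu\in\mathbb{N}}$ such that the following hold. (a) $\mathbb{P}$-almost surely, for all sufficiently large $\nu\in\mathbb{N}$, $\boldsymbol{x}^\nu$ is a local minimizer of $\frac1\nu\sum_{i=1}^\nu h(\boldsymbol{\xi}^i,\cdot)$. (b) $\mathbb{P}$-almost surely, one has $\boldsymbol{x}^\nu\to x\in X$ as $\nu\to\infty$, but $0\notin\partial\,\mathbb{E}[h(\boldsymbol{\xi},\cdot)](x)$.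
   Context: $\mathbb{N}=\{1,2,\ldots\}$. A function $h:\Xi\times\mathbb{R}\to\mathbb{R}$ is Carathéodory if $h(\xi,\cdot)$ is continuous for each $\xi$ and $h(\cdot,x)$ is Borel measurable for each $x$. Random points are measurable maps on $(\Omega,\mathcal{F})$. $\partial\,\mathbb{E}[h(\boldsymbol{\xi},\cdot)](x)$ denotes the Clarke subdifferential at $x$ of the (locally Lipschitz near $X$) function $y\mapsto\mathbb{E}[h(\boldsymbol{\xi},y)]$. ''$\mathbb{P}$-almost surely'' means for all $\omega$ in a set of $\mathbb{P}$-probability one. *)

(* Defs.v *)
From HB Require Import structures.
From mathcomp Require Import all_boot all_order all_algebra finmap.
From mathcomp Require Import all_classical all_reals all_analysis.
Set Implicit Arguments.
Unset Strict Implicit.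
Unset Printing Implicit Defensive.
Import Order.TTheory GRing.Theory Num.Theory.
Import numFieldNormedType.Exports.
Local Open Scope classical_set_scope.
Local Open Scope ring_scope.

(* Mutual independence of a (possibly infinite) family of random variables:
   the product rule over every finite subfamily. *)
Definition mutually_independent d d' (T : measurableType d)
    (T' : measurableType d') (R : realType) (P : probability T R)
    (I : choiceType) (X : I -> {RV P >-> T'}) : Prop :=
  forall (J : {fset I}) (A : I -> set T'),
    (forall i, measurable (A i)) ->
    (P (\bigcap_(i in [set` J]) (X i @^-1` A i)) =
     \prod_(i <- J) P (X i @^-1` A i))%E.

(* Equality of laws is asked on measurable sets only, since
   [uniform_prob] carries no meaning on the others. *)
Definition uniform01 d (T : measurableType d) (R : realType)
    (P : probability T R) (X : {RV P >-> R}) : Prop :=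
  forall A : set R, measurable A ->
    distribution P X A = uniform_prob (@ltr01 R) A.

(* Functions on S * R are represented by total functions R -> R -> R whose
   first argument is only ever constrained on S. *)
Definition caratheodory_on (R : realType) (S : set R) (h : R -> R -> R) : Prop :=
  (forall s, S s -> continuous (h s)) /\
  (forall x, measurable_fun S (h ^~ x)).

Definition local_minimizer (R : realType) (f : R -> R) (x : R) : Prop :=
  \forall y \near x, f x <= f y.

(* Clarke's generalized directional derivative
     limsup_(y -> x, t -> 0+) (f (y + t * v) - f y) / t ;
   the pair p is (y, t). *)
Definition clarke_dirderiv (R : realType) (f : R -> R) (x v : R) : \bar R :=
  limf_esup (fun p : R * R => ((f (p.1 + p.2 * v) - f p.1) / p.2)%:E)
            (filter_prod (nbhs x) (0 : R)^'+).

Definition clarke_subdiff (R : realType) (f : R -> R) (x : R) : set R :=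
  [set s | forall v, ((s * v)%:E <= clarke_dirderiv f x v)%E].

(* Main.v *)
Require Import Defs.
From HB Require Import structures.
From mathcomp Require Import all_boot all_order all_algebra finmap.
From mathcomp Require Import all_classical all_reals all_analysis.
From mathcomp Require Import measurable_realfun.
From mathcomp Require Import ring lra.
Set Implicit Arguments.
Unset Strict Implicit.
Unset Printing Implicit Defensive.
Import Order.TTheory GRing.Theory Num.Theory.
Import numFieldNormedType.Exports.
Local Open Scope classical_set_scope.
Local Open Scope ring_scope.

(** Independence of the sample plays no role.  Let s_0, s_1, ... enumerate the
    finite sequences of naturals, and let A_k be the union of the cells
    [j/N, (j+1)/N) for j in s_k, where N = 4 |s_k|; thus A_k has measure at
    most 1/4, while any finite set of points of [0, 1] is contained in A_k for
    infinitely many k.  Take disjointly supported tents of slope 1 centred at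
    2^-k, and let h(s, x) be x minus twice the k-th tent when s is in A_k.  If
    xi^1, ..., xi^n all lie in A_k, every summand h(xi^i, .) has a local
    minimum at 2^-k, and so has the average; choosing such a k > n gives
    x^n -> 0.  However, the mean of h(xi, .) has slope at least
    1 - 2/4 = 1/2. *)

(** * Disjointly supported tents accumulating at 0 *)

Section tents.
Context {R : realType}.
Implicit Types (x y : R) (k : nat).

Definition peak k : R := 2^-1 ^+ k.

Definition near_peak x : set nat := [set k | `|x - peak k| < peak k / 4].

(* Junk value 0 off the supports of the tents. *)
Definition tent_index x : nat := xget 0%N (near_peak x).

(** The maximum with 0 neutralizes the junk index: off all supports the index is 0, and [x] is then
    outside the support of the tent at [peak 0], so the value is 0. *)
Definition tent x : R :=
  Num.max 0 (peak (tent_index x) / 4 - `|x - peak (tent_index x)|).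

Lemma peak_gt0 k : 0 < peak k.
Proof. by rewrite exprn_gt0. Qed.

Lemma peak_le1 k : peak k <= 1.
Proof. by rewrite exprn_ile1//; lra. Qed.

(** For [j < k], the [k]-th support lies below 5/8 of [peak j], the [j]-th above 3/4 of it. *)
Lemma near_peak_inj x j k : near_peak x j -> near_peak x k -> j = k.
Proof.
wlog jk : j k / (j <= k)%N.
  by move=> H ? ?; case/orP: (leq_total j k) => ?; [|symmetry]; exact: H.
rewrite /near_peak/= => xj xk; apply/eqP; rewrite eqn_leq jk leqNgt/=.
apply/negP => ltjk.
have : peak k <= peak j / 2.
  by rewrite /peak -exprSr ler_wiXn2l//; lra.
move: xj xk (peak_gt0 j) (peak_gt0 k); rewrite !ltr_norml.
by move=> /andP[? ?] /andP[? ?] ? ? ?; lra.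
Qed.

Lemma tent_indexE x k : near_peak x k -> tent_index x = k.
Proof.
move=> xk; rewrite /tent_index; case: xgetP => [j _ xj|/(_ k)//].
exact: near_peak_inj xj xk.
Qed.

Lemma tent_near x k : near_peak x k -> tent x = peak k / 4 - `|x - peak k|.
Proof.
move=> xk; rewrite /tent (tent_indexE xk); apply: max_r.
by rewrite subr_ge0 ltW.
Qed.

Lemma near_peak_peak k : near_peak (peak k) k.
Proof. by rewrite /near_peak/= subrr normr0 divr_gt0// peak_gt0. Qed.

Lemma tent_ge0 x : 0 <= tent x.
Proof. by rewrite /tent le_max lexx. Qed.

Lemma tent_le_dist x y : ~ near_peak y (tent_index x) -> tent x <= `|x - y|.
Proof.
move=> /negP; rewrite -leNgt => ry; rewrite /tent ge_max normr_ge0/=.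
by have := ler_distD x y (peak (tent_index x)); rewrite (distrC y x); lra.
Qed.

Lemma tent_lipschitz x y : tent_index x = tent_index y ->
  `|tent x - tent y| <= `|x - y|.
Proof.
rewrite /tent => ->; set p := peak _.
have := ler_distD y x p; have := ler_distD x y p; have := normr_ge0 (x - y).
rewrite (distrC y x).
move: `|x - p| `|y - p| => u v ? ? ?.
rewrite ler_norml /Num.max.
by case: (ltP 0 (_ - u)); case: (ltP 0 (_ - v)) => ? ?; apply/andP; split; lra.
Qed.

(* Between two tents both weighted heights are at most C times the distance, so
   the disjointly supported pieces glue without loss in the constant. *)
Lemma weighted_tent_lipschitz (c : nat -> R) (C : R) :
  (forall k, 0 <= c k <= C) -> forall x y,
  `|c (tent_index x) * tent x - c (tent_index y) * tent y| <= C * `|x - y|.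
Proof.
move=> c0C x y.
have C0 : 0 <= C by have /andP[/le_trans] := c0C 0%N; exact.
have cC k : `|c k| <= C by have /andP[? ?] := c0C k; rewrite ger0_norm.
have [xy|xy] := eqVneq (tent_index x) (tent_index y).
  by rewrite -xy -mulrBr normrM ler_pM// tent_lipschitz.
suff H a b : tent_index a <> tent_index b ->
    0 <= c (tent_index a) * tent a <= C * `|a - b|.
  have /andP[? ?] := H x y (elimN eqP xy).
  have /andP[? ?] : 0 <= c (tent_index y) * tent y <= C * `|x - y|.
    by rewrite (distrC x y); apply: H => /esym; exact/eqP.
  by rewrite ler_norml; apply/andP; split; lra.
move=> ab; have /andP[c0 cC'] := c0C (tent_index a).
rewrite mulr_ge0 ?tent_ge0//= ler_pM ?tent_ge0//.
by apply: tent_le_dist => /tent_indexE /esym.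
Qed.

End tents.

(** * Unions of cells of small uniform measure *)

Section cells.
Context {R : realType}.

Definition cells (N : nat) (s : seq nat) : set R :=
  \big[setU/set0]_(j <- s) `[j%:R / N%:R, j.+1%:R / N%:R[%classic.

Definition coded_cells (k : nat) : set R :=
  let s := CodeSeq.decode k in cells (4 * size s) s.

Lemma measurable_cells N s : measurable (cells N s).
Proof. by apply: bigsetU_measurable => j _; exact: measurable_itv. Qed.

Lemma mem_cells N s (x : R) : (0 < N)%N -> 0 <= x ->
  Num.trunc (x * N%:R) \in s -> cells N s x.
Proof.
move=> N0 x0 xs; rewrite /cells -bigcup_seq; exists (Num.trunc (x * N%:R)) => //=.
have N0R : 0 < N%:R :> R by rewrite ltr0n.
by rewrite in_itv/= ler_pdivrMr// ltr_pdivlMr// truncn_itv// mulr_ge0// ltW.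
Qed.

(** The density is at most 1. Equality can fail, since cells with [j >= N] lie beyond the unit
    interval. *)
Lemma uniform_prob_itvco_le (a b : R) : a <= b ->
  (uniform_prob (@ltr01 R) `[a, b[%classic <= (b - a)%:E)%E.
Proof.
move=> ab; rewrite /uniform_prob.
apply: (@le_trans _ _ (\int[lebesgue_measure]_(x in `[a, b[) cst 1%E x)%E).
  apply: ge0_le_integral => //.
  - by move=> x _; rewrite lee_fin uniform_pdf_ge0.
  - apply/measurable_EFinP; apply: measurable_funTS.
    exact: measurable_uniform_pdf.
  - move=> x _; rewrite lee_fin /uniform_pdf subr0 invr1.
    by case: ifP => // _; exact: ler01.
rewrite integral_cst//= mul1e lebesgue_measure_itv/= lte_fin.
by case: ifP => // _; rewrite lee_fin subr_ge0.
Qed.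

Lemma uniform_prob_cells_le N s :
  (uniform_prob (@ltr01 R) (cells N s) <= ((size s)%:R / N%:R)%:E)%E.
Proof.
elim: s => [|j s IH]; first by rewrite /cells big_nil measure0 mul0r.
rewrite /cells big_cons.
apply: le_trans (measureU2 _ _ _) _ => //.
  exact: measurable_cells.
rewrite /= -(addn1 (size s)) natrD mulrDl EFinD addeC leeD//.
apply: le_trans (uniform_prob_itvco_le _) _.
  by rewrite ler_wpM2r// ler_nat.
by rewrite lee_fin -mulrBl -natr1; rewrite addrAC subrr add0r.
Qed.

Lemma uniform_prob_coded_cells_le k :
  (uniform_prob (@ltr01 R) (coded_cells k) <= (1 / 4)%:E)%E.
Proof.
apply: le_trans (uniform_prob_cells_le _ _) _; rewrite lee_fin.
(* For the empty sequence the bound is 0 / 0, which is 0 by convention. *)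
case: (size _) => [|n]; first by rewrite mul0r.
by rewrite natrM invfM mulrCA mulfV ?mulr1 ?mul1r// pnatr_eq0.
Qed.

End cells.

(** * The integrand, its local minima and its mean *)

Section objective.
Context {R : realType}.
Implicit Types (s x y : R) (k : nat).

(** The factor 2 beats the unit slope of the linear term: on an active tent the slope is -1 left of
    the peak and 3 right of it. *)
Definition objective s x : R :=
  x - 2 * (\1_(coded_cells (tent_index x)) s * tent x).

Lemma objective_lipschitz s x y :
  `|objective s x - objective s y| <= 3 * `|x - y|.
Proof.
pose c k : R := \1_(coded_cells k) s.
have c01 k : 0 <= c k <= 1 by rewrite /c indicE; case: (_ \in _) => /=; lra.
have := weighted_tent_lipschitz c01 x y; rewrite /objective /c.
move: (_ * tent x) (_ * tent y) => u v uv.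
have -> : x - 2 * u - (y - 2 * v) = (x - y) - 2 * (u - v) by ring.
by rewrite (le_trans (ler_normB _ _))// normrM ger0_norm//; lra.
Qed.

Lemma continuous_objective s : continuous (objective s).
Proof.
move=> x; apply/cvgrPdist_lt => e e0; near=> y.
rewrite (le_lt_trans (objective_lipschitz _ _ _))//.
rewrite -ltr_pdivlMl//; near: y.
by apply: cvgr_dist_lt; [exact: cvg_id|rewrite mulr_gt0].
Unshelve. all: by end_near. Qed.

Lemma measurable_objective x : measurable_fun setT (objective ^~ x).
Proof.
apply: measurable_funB => //; apply: measurable_funM => //.
apply: measurable_funM => //; apply: measurable_indic.
exact: measurable_cells.
Qed.

Lemma objective_peak_le s k y : coded_cells k s -> near_peak y k ->
  objective s (peak k) <= objective s y.
Proof.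
move=> sk yk; rewrite /objective (tent_indexE yk) (tent_near yk).
rewrite (tent_indexE (near_peak_peak k)) (tent_near (near_peak_peak k)).
rewrite indicE mem_set//= subrr normr0.
have := normr_ge0 (y - peak k); have := ler_norm (peak k - y).
by rewrite distrC; lra.
Qed.

(** All summands are minimal at [peak k] over the same neighbourhood, the support of the [k]-th
    tent, so the inequalities add up. *)
Lemma local_minimizer_average (I : eqType) (r : seq I) (s : I -> R) (a : R) k :
  0 <= a -> {in r, forall i, coded_cells k (s i)} ->
  local_minimizer (fun y => a * \sum_(i <- r) objective (s i) y) (peak k).
Proof.
move=> a0 rk; rewrite /local_minimizer; near=> y.
rewrite ler_wpM2l// big_seq [leRHS]big_seq ler_sum// => i /rk ik.
apply: objective_peak_le ik _; rewrite /near_peak/= distrC; near: y.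
by apply: cvgr_dist_lt; [exact: cvg_id|rewrite divr_gt0// peak_gt0].
Unshelve. all: by end_near. Qed.

(** For fixed [y] only one tent is involved, so the integrand is affine in the indicator of a single
    event. *)
Lemma expectation_objective d (T : measurableType d) (P : probability T R)
    (X : {RV P >-> R}) y :
  ('E_P[fun w => objective (X w) y] =
   (y - 2 * (fine (distribution P X (coded_cells (tent_index y)))
             * tent y))%:E)%E.
Proof.
set A := coded_cells _; have mA : measurable A by exact: measurable_cells.
have mXA : measurable (X @^-1` A).
  by rewrite -[_ @^-1` _]setTI; exact: measurable_funP.
rewrite unlock /objective -/A.
transitivity (\int[P]_w
    (cst y%:E w - (2 * tent y)%:E * (\1_(X @^-1` A) w)%:E))%E.
  apply: eq_integral => w _; rewrite -EFinM -EFinB -mulrA (mulrC (tent y)).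
  by rewrite !indicE.
rewrite integralB//; last 2 first.
- exact: finite_measure_integrable_cst.
- by apply: integrableZl => //; exact: integrable_indic.
have -> : (\int[P]_w cst y%:E w = y%:E)%E.
  by rewrite integral_cst// [X in (_ * X)%E](probability_setT P) mule1.
rewrite integralZl//; last exact: integrable_indic.
rewrite integral_indic// setIT.
rewrite EFinB (mulrC (fine _)) mulrA (EFinM _ (fine _)) fineK//; exact: fin_num_measure.
Qed.

(** The tents weighted by [p] are 1/4-Lipschitz, so doubling and subtracting them costs at most half
    of the increment [y - x]. *)
Lemma mean_objective_slope (p : nat -> R) x y :
  (forall k, 0 <= p k <= 1 / 4) -> x <= y ->
  x - 2 * (p (tent_index x) * tent x) + (y - x) / 2
  <= y - 2 * (p (tent_index y) * tent y).
Proof.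
move=> p14 xy; have := weighted_tent_lipschitz p14 x y.
rewrite ler_norml (distrC x) (ger0_norm (_ : 0 <= y - x)) ?subr_ge0//.
by move=> /andP[? ?]; lra.
Qed.

(** In direction -1 every difference quotient with positive step is at most [- c], hence so is the
    generalized derivative. *)
Lemma clarke_subdiff_increasing (f : R -> R) (c x : R) : 0 < c ->
  (forall u v, u <= v -> f u + c * (v - u) <= f v) ->
  ~ clarke_subdiff f x 0.
Proof.
move=> c0 fc /(_ (-1)); rewrite mul0r; apply/negP; rewrite -ltNge.
apply: (@le_lt_trans _ _ (- c)%:E); last by rewrite lte_fin oppr_lt0.
(* The upper limit is an infimum over the sets of the filter; this one set already gives the
   bound. *)
pose V := [set p : R * R | 0 < p.2].
apply: le_trans (ereal_inf_lbound _) _.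
  exists V; last by [].
  exists (setT, [set t | 0 < t]); last by case=> ? ? [].
  by split; [exact: filterT|exact: nbhs_right_gt].
apply: ge_ereal_sup => _ [[u t] /= t0 <-]; rewrite lee_fin.
rewrite ler_pdivrMr//; have := fc (u - t) u.
by rewrite gerBl (ltW t0) mulrN1 => /(_ isT); lra.
Qed.

End objective.

(** * Coding the sample, and measurability of the chosen peak *)

Section sampling.
Context {R : realType}.

(* The leading [n] forces the code to exceed [n]; the extra cell it adds to the
   covering of the sample is harmless. *)
Definition sample_code (xi : nat -> R) (n : nat) : nat :=
  CodeSeq.code (n :: [seq Num.trunc (xi i * (4 * n.+1)%:R) | i <- iota 1 n]).

Lemma ltn_sample_code (xi : nat -> R) n : (n < sample_code xi n)%N.
Proof.
rewrite /sample_code; set s := map _ _.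
by have /andP[] := CodeSeq.ltn_code (n :: s).
Qed.

Lemma mem_coded_cells_sample (xi : nat -> R) n i : (forall j, 0 <= xi j) ->
  i \in iota 1 n -> coded_cells (sample_code xi n) (xi i).
Proof.
move=> xi0 i1n; rewrite /coded_cells /sample_code CodeSeq.codeK/=.
(* The decoded sequence has [n.+1] entries, so its cells have exactly the scale [4 * n.+1] used to
   truncate the sample. *)
rewrite size_map size_iota; apply: mem_cells => //.
by rewrite inE; apply/orP; right; apply/mapP; exists i.
Qed.

Lemma measurable_seq_preimage d (T : measurableType d) (I : Type) (J : countType)
    (f : I -> T -> J) (l : seq I) (s : seq J) :
  (forall i j, measurable (f i @^-1` [set j])) ->
  measurable [set w | [seq f i w | i <- l] = s].
Proof.
move=> mf; elim: l s => [|i l IH] [|j s] /=.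
- by rewrite (_ : [set _ | _] = setT)//; apply/seteqP; split.
- by rewrite (_ : [set _ | _] = set0)//; apply/seteqP; split.
- by rewrite (_ : [set _ | _] = set0)//; apply/seteqP; split.
rewrite (_ : [set _ | _] =
    (f i @^-1` [set j]) `&` [set w | [seq f i w | i <- l] = s]).
  exact: measurableI.
by apply/seteqP; split => w /=; [case=> -> ->|case=> -> ->].
Qed.

(** A preimage is a countable union of fibres of [g], so [J] needs no sigma-algebra. *)
Lemma measurable_countable_comp d d' (T : measurableType d)
   (U : measurableType d') (J : countType) (g : T -> J) (h : J -> U) :
  (forall j, measurable (g @^-1` [set j])) -> measurable_fun setT (h \o g).
Proof.
move=> mg _ B mB; rewrite setTI.
rewrite (_ : _ @^-1` B = \bigcup_(j in h @^-1` B) (g @^-1` [set j])).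
  rewrite bigcup_mkcond; apply: countable_bigcupT_measurable => // j.
  by case: ifP.
apply/seteqP; split => [w /= hB|w /= [j /= hB ->]//].
by exists (g w).
Qed.

(** The peak depends on the sample only through its truncations, a sequence with countably many
    possible values. *)
Lemma measurable_peak_sample d (T : measurableType d) (xi : nat -> T -> R) n :
  (forall i, measurable_fun setT (xi i)) -> (forall i w, 0 <= xi i w) ->
  measurable_fun setT (fun w => peak (sample_code (xi ^~ w) n) : R).
Proof.
move=> mxi xi0.
apply: (@measurable_countable_comp _ _ _ _ _
  (fun w => [seq Num.trunc (xi i w * (4 * n.+1)%:R) | i <- iota 1 n])
  (fun s => peak (CodeSeq.code (n :: s)))) => s.
apply: measurable_seq_preimage => i j.
have -> : (fun w => Num.trunc (xi i w * (4 * n.+1)%:R)) @^-1` [set j] =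
    xi i @^-1` `[j%:R / (4 * n.+1)%:R, j.+1%:R / (4 * n.+1)%:R[%classic.
  apply/seteqP; split => w /=;
    rewrite in_itv/= ler_pdivrMr ?ltr0n// ltr_pdivlMr ?ltr0n//.
    by move=> <-; rewrite truncn_itv// mulr_ge0.
  by rewrite -truncn_eq ?mulr_ge0// => /eqP.
by rewrite -[_ @^-1` _]setTI; exact: mxi.
Qed.

End sampling.

(* xi 0 is the random variable \boldsymbol{\xi}, and xi i for i >= 1 is
   \boldsymbol{\xi}^i. *)
Theorem corollary3 (R : realType) (d : measure_display) (T : measurableType d)
    (P : probability T R) (complP : measure_is_complete P)
    (xi : nat -> {RV P >-> R})
    (xi_range : forall i w, xi i w \in `[0, 1])
    (xi_indep : mutually_independent xi)
    (xi_unif : forall i, uniform01 (xi i)) :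
  exists (h : R -> R -> R) (L : R -> R) (x : nat -> {RV P >-> R}),
    [/\ [/\ caratheodory_on `[0, 1]%classic h,
            (forall y, 'E_P[fun w => h (xi 0%N w) y] \is a fin_num)%E,
            (exists O : set R, [/\ open O, `[0, 1]%classic `<=` O &
               forall s, s \in `[0, 1] -> (L s).-lipschitz_O (h s)]),
            measurable_fun (`[0, 1]%classic : set R) L &
            ('E_P[fun w => L (xi 0%N w)] < +oo)%E],
        (forall n w, x n w \in `[0, 1]),
        {ae P, forall w, \forall n \near \oo,
           local_minimizer
             (fun y => n%:R^-1 * \sum_(1 <= i < n.+1) h (xi i w) y) (x n w)} &
        {ae P, forall w, exists x0 : R,
           [/\ x0 \in `[0, 1],
               x n w @[n --> \oo] --> x0 &
               ~ clarke_subdiff (fun y => fine 'E_P[fun w' => h (xi 0%N w') y])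
                   x0 0]}].
Proof.
have xi0 i w : 0 <= xi i w by have := xi_range i w; rewrite in_itv => /andP[].
pose p k := fine (distribution P (xi 0%N) (coded_cells k)).
have p14 k : 0 <= p k <= 1 / 4.
  have mA := @measurable_cells R (4 * size (CodeSeq.decode k)) (CodeSeq.decode k).
  rewrite fine_ge0 ?measure_ge0//= -lee_fin fineK; last exact: fin_num_measure.
  by rewrite xi_unif// uniform_prob_coded_cells_le.
pose X n w : R := peak (sample_code (fun i => xi i w) n).
have mX n : measurable_fun setT (X n).
  by apply: measurable_peak_sample => // i; exact: measurable_funP.
exists objective, (cst 3), (fun n => mfun_Sub (mem_set (mX n))).
split=> [|n w||].
- split=> //.
  + split=> [s _|x]; first exact: continuous_objective.
    by apply: measurable_funTS; exact: measurable_objective.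
  + by move=> y; rewrite expectation_objective.
  + exists setT; split; [exact: openT|by []|move=> s _ [x y] _ /=].
    exact: objective_lipschitz.
  + by rewrite expectation_cst ltry.
- by rewrite in_itv/= ltW ?peak_gt0// peak_le1.
(* This holds for every [w]: the set coded by [sample_code] contains the points [xi 1] to [xi n]. *)
- apply: aeW => w; near=> n.
  apply: local_minimizer_average => // i; rewrite /index_iota subn1/= => i1n.
  exact: mem_coded_cells_sample.
- apply: aeW => w; exists 0; split.
  + by rewrite in_itv/= lexx ler01.
  (* The code exceeds [n] and [peak] decreases, whence the upper bound [peak n]. *)
  + apply: (@squeeze_cvgr _ _ _ _ (cst 0) (fun n => peak n)).
    * near=> n; rewrite ltW ?peak_gt0//=.
      by rewrite ler_wiXn2l ?invr_ge0 ?invf_le1 ?ler1n// ltnW// ltn_sample_code.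
    * exact: cvg_cst.
    * by apply: cvg_expr; rewrite ger0_norm ?invf_lt1 ?ltr1n.
  + apply: (@clarke_subdiff_increasing _ _ 2^-1) => // u v uv.
    rewrite !expectation_objective /= -/(p _) -/(p _).
    by have := mean_objective_slope p14 uv; rewrite (mulrC 2^-1).
Unshelve. all: by end_near. Qed.
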